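(* Let $X$ be a nonempty compact metrizable space, $T:X\to X$ a homeomorphism, and $d\ge 1$ an integer. Let $P\subset X$ be the set of periodic points of $T$, let $\Delta=\{(x,x): x\in X\}$, and let $D_{(P\times P)\setminus\Delta}$ be the set of $f\in C(X,[0,1]^d)$ such that for every $(x,y)\in (P\times P)\setminus \Delta$ there exists $i\in\mathbb{Z}$ with $f(T^i(x))\neq f(T^i(y))$. If $\mathrm{perdim}(X,T)<\frac d2$, then $D_{(P\times P)\setminus\Delta}$ is dense in $C(X,[0,1]^d)$ for the uniform distance.
   Context: Topological dimension: for a finite open cover $\alpha$ of a space $Y$, $\mathrm{ord}(\alpha)=\sup_{y\in Y}\left(\sum_{U\in\alpha}\mathbf 1_U(y)\right)-1$; a cover $\beta$ refines $\alpha$ (written $\beta\succ\alpha$) if each element of $\beta$ is contained in some element of $\alpha$; $D(\alpha)=\min_{\beta\succ\alpha}\mathrm{ord}(\beta)$, over finite open covers $\beta$ of $Y$; and $\dim(Y)=\sup_\alpha D(\alpha)$ over finite open covers $\alpha$ of $Y$. Convention: $\dim(\emptyset)=0$. For an integer $k\ge1$, $P_k$ is the set of periodic points of $(X,T)$ of (minimal) period at most $k$. The periodic dimension is $\mathrm{perdim}(X,T)=\sup_{k\ge1}\frac{\dim(P_k)}{k}$. $C(X,[0,1]^d)$ is the space of continuous maps $X\to[0,1]^d$. *)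

(* Defs.v *)
From HB Require Import structures.
From mathcomp Require Import all_boot all_order all_algebra.
From mathcomp Require Import finmap.
From mathcomp Require Import all_classical all_reals.
From mathcomp Require Import ereal topology numfun normedtype.

Set Implicit Arguments.
Unset Strict Implicit.
Unset Printing Implicit Defensive.

Import Order.TTheory GRing.Theory Num.Theory.
Import numFieldNormedType.Exports.

Local Open Scope classical_set_scope.
Local Open Scope ring_scope.

Definition metrizable (R : realType) (X : topologicalType) : Prop :=
  exists dist : X -> X -> R,
    [/\ forall x, dist x x = 0,
        forall x y, dist x y = 0 -> x = y,
        forall x y, dist x y = dist y x,
        forall y x z, dist x z <= dist x y + dist y z &
        forall A : set X, open A <->
          forall x, A x -> exists2 e : R, 0 < e & [set y | dist x y < e] `<=` A].

Record homeo (X Y : topologicalType) := Homeo {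
  homeo_fun :> X -> Y;
  homeo_inv : Y -> X;
  homeo_fun_continuous : continuous homeo_fun;
  homeo_inv_continuous : continuous homeo_inv;
  homeo_funK : cancel homeo_fun homeo_inv;
  homeo_invK : cancel homeo_inv homeo_fun }.

(* Negz n stands for -(n + 1). *)
Definition iterz (X : topologicalType) (T : homeo X X) (i : int) : X -> X :=
  match i with
  | Posz n => iter n T
  | Negz n => iter n.+1 (homeo_inv T)
  end.

Section dimension.
Variables (R : realType) (Y : topologicalType).
Implicit Types alpha beta : {fset (set Y)}.

Definition open_cover : set {fset (set Y)} :=
  [set alpha : {fset (set Y)} |
     (forall U, U \in alpha -> open U) /\
     (forall y, exists2 U, U \in alpha & U y)].

Definition refines beta alpha : Prop :=
  forall V, V \in beta -> exists2 U, U \in alpha & V `<=` U.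

Definition cover_ord alpha : \bar R :=
  (ereal_sup [set (\sum_(U <- alpha) \1_U y)%:E | y in [set: Y]] - 1)%E.

(* For nonempty Y the orders of covers are natural numbers, so that this
   infimum is attained. *)
Definition cover_dim alpha : \bar R :=
  ereal_inf [set cover_ord beta |
              beta in [set beta | open_cover beta /\ refines beta alpha]].

(* The convention for the empty space has to be imposed: the supremum would
   otherwise be -oo. *)
Definition topdim : \bar R :=
  if [set: Y] == set0 then 0%E
  else ereal_sup [set cover_dim alpha | alpha in open_cover].

End dimension.

Section periodic_points.
Variables (X : topologicalType) (T : homeo X X).

Definition periodic_points : set X :=
  [set x | exists2 n, (0 < n)%N & iter n T x = x].

Definition minimal_period (n : nat) (x : X) : Prop :=
  [/\ (0 < n)%N, iter n T x = x &
      forall m, (0 < m < n)%N -> iter m T x <> x].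

Definition periodic_upto (k : nat) : set X :=
  [set x | exists2 n, (n <= k)%N & minimal_period n x].

(* The type of points of periodic_upto k carries the subspace topology. *)
Definition perdim (R : realType) : \bar R :=
  ereal_sup [set (topdim R (set_type (periodic_upto k)) * (k%:R^-1)%:E)%E |
              k in [set k : nat | (1 <= k)%N]].

End periodic_points.

Section observables.
Variables (R : realType) (X : topologicalType) (d : nat).

(* C(X, [0,1]^d), with R^d the row vectors and their supremum norm *)
Definition cube_maps : set (X -> 'rV[R]_d) :=
  [set f : X -> 'rV[R]_d | continuous f /\ forall x i, 0 <= f x ord0 i <= 1].

Definition unif_dist (f g : X -> 'rV[R]_d) : \bar R :=
  ereal_sup [set `|f x - g x|%:E | x in [set: X]].

Definition unif_dense_in (D C : set (X -> 'rV[R]_d)) : Prop :=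
  forall f, C f -> forall e : R, 0 < e ->
    exists2 g, D g & (unif_dist f g < e%:E)%E.

Definition separating_maps (T : homeo X X) (K : set (X * X)) :
    set (X -> 'rV[R]_d) :=
  [set f | cube_maps f /\
    forall x y, K (x, y) -> exists i : int, f (iterz T i x) <> f (iterz T i y)].

End observables.

Arguments cube_maps : clear implicits.
Arguments separating_maps R {X} d T K.

(* Main.v *)
(* Baire category argument. Cover the pairs of distinct periodic points by
   countably many compact pieces and perturb an observable on one piece at a
   time. Near a point x of minimal period n, the orbit map
   z |-> (f z, f (T z), ..., f (T^(n-1) z)) on the points of period n takes
   values in R^(nd), and since dim P_n < nd/2 it can be replaced by a map into a
   polyhedron with vertices in general position, all of whose simplices have
   dimension < nd/2. Two points on different orbits, of periods n <= m, are then
   separated because two simplices of dimensions < nd/2 <= md/2 and < md/2 in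
   general position in R^(md) are disjoint; two points of the same orbit are
   separated because the polyhedron misses the subspaces of q-periodic
   sequences, of dimension qd <= nd/2, for q a proper divisor of n. *)

Require Import Defs.
From HB Require Import structures.
From mathcomp Require Import all_boot all_order all_algebra.
From mathcomp Require Import finmap.
From mathcomp Require Import all_classical all_reals.
From mathcomp Require Import ereal topology numfun normedtype derive.
From mathcomp Require Import zify lra.

Set Implicit Arguments.
Unset Strict Implicit.
Unset Printing Implicit Defensive.

Import Order.TTheory GRing.Theory Num.Theory.
Import numFieldNormedType.Exports.

Local Open Scope classical_set_scope.
Local Open Scope ring_scope.

(** * General position *)

(** Homogeneous coordinates: affine subspaces of R^N become row spaces in R^(N+1), with rank one
    more than the affine dimension. *)
Definition homog (R : realType) (N : nat) (v : 'rV[R]_N) : 'rV[R]_(N + 1) :=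
  row_mx v 1.

Lemma small_nonroot (R : realType) (q : {poly R}) : q != 0 ->
  exists2 t : R, 0 <= t <= 1 & ~~ root q t.
Proof.
move=> q0; apply: contrapT => noroot.
(* These are [size q] distinct points of [0,1], one more than the degree of [q], so they cannot all
   be roots. *)
pose ts := [seq (i.+1%:R^-1 : R) | i <- iota 0 (size q)].
have := max_poly_roots q0 (rs := ts).
rewrite size_map size_iota ltnn => H; suff : false by [].
apply: H.
  apply/allP => _ /mapP[i _ ->]; apply: contrapT => /negP nr.
  apply: noroot; exists i.+1%:R^-1 => //.
  by rewrite invr_ge0 ler0n invf_le1 ?ltr0n// ler1n.
rewrite map_inj_uniq ?iota_uniq// => i j /invr_inj /eqP.
by rewrite eqr_nat => /eqP [].
Qed.

(* On the moment curve [t -> w + e (t, t^2, ..., t^N)] a nonzero affine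
   functional restricts to a nonzero polynomial in [t]. *)
Lemma avoid_subspaces (R : realType) (N : nat) (Ws : seq 'M[R]_(N + 1))
    (w : 'rV[R]_N) (e : R) : 0 < e ->
  exists v : 'rV[R]_N, (forall j, `|v 0 j - w 0 j| <= e) /\
    forall W, W \in Ws -> (\rank W < N + 1)%N ->
      ~~ (homog v <= W)%MS.
Proof.
move=> e0.
pose v t : 'rV[R]_N := \row_j (w 0 j + e * t ^+ j.+1).
(* A single polynomial serves all of [Ws]: the product of those attached to the proper subspaces. *)
have [q q0 qP] : exists2 q : {poly R}, q != 0 & forall t, ~~ root q t ->
    forall W, W \in Ws -> (\rank W < N + 1)%N ->
      ~~ (homog (v t) <= W)%MS.
  elim: Ws => [|W Ws [q q0 qP]]; first by exists 1; rewrite ?oner_neq0.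
  have [rW|rW] := leqP (N + 1) (\rank W).
    exists q => // t qt W'; rewrite inE => /orP[/eqP -> | /qP]; last exact.
    by rewrite ltnNge rW.
  have /eqP : cokermx W != 0.
    by rewrite -mxrank_eq0 mxrank_coker -lt0n subn_gt0.
  have [/existsP[i /existsP[k ck]] _|] :=
    boolP [exists i, [exists k, cokermx W i k != 0]]; last first.
    rewrite negb_exists => /forallP H ck; exfalso; apply: ck.
    apply/matrixP => i k; rewrite [RHS]mxE; apply/eqP.
    by have := H i; rewrite negb_exists => /forallP/(_ k)/negPn.
  (* A nonzero linear functional vanishing on [W]; [p] is its restriction to the curve. *)
  pose c := col k (cokermx W).
  pose c1 := usubmx c; pose c2 := dsubmx c.
  pose p : {poly R} := \sum_(j < N)
     c1 j 0 *: ((w 0 j)%:P + e *: 'X^(j.+1)) + (c2 0 0)%:P.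
  have pE t : (homog (v t) *m c) 0 0 = p.[t].
    rewrite -[c]vsubmxK /homog mul_row_col mxE mul1mx mxE /p hornerD hornerC.
    rewrite horner_sum; congr (_ + _); apply: eq_bigr => j _.
    by rewrite mxE !hornerE mulrC.
  have p0 : p != 0.
    apply: contraNneq ck => p0.
    (* The coefficient of t^(j+1) in [p] is [e] times [c1 j 0]; once these vanish, the constant term
       is [c2 0 0]. *)
    have c10 j : c1 j 0 = 0.
      have /eqP := congr1 (fun r : {poly R} => r`_(j.+1)) p0.
      rewrite coef0 coefD coefC /= addr0 coef_sum (bigD1 j)//= big1 => [|l lj].
        rewrite addr0 coefZ coefD coefC coefZ coefXn eqxx add0r mulr1.
        by rewrite mulf_eq0 (gt_eqF e0) orbF => /eqP.
      have jl : (j == l :> nat) = false.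
        by apply/negbTE; rewrite eq_sym.
      by rewrite coefZ coefD coefC coefZ coefXn eqSS jl mulr0 addr0 mulr0.
    have c20 : c2 0 0 = 0.
      move: p0; rewrite /p big1 => [|j _]; last by rewrite c10 scale0r.
      by rewrite add0r => /eqP; rewrite polyC_eq0 => /eqP.
    have : c = 0.
      rewrite -[c]vsubmxK -/c1 -/c2; apply/matrixP => a b; rewrite mxE.
      case: splitP => j _; rewrite [in RHS]mxE (ord1 b) ?c10//.
      by rewrite (ord1 j).
    by move=> /matrixP /(_ i 0); rewrite !mxE => ->.
  exists (q * p); rewrite ?mulf_neq0// => t.
  rewrite rootM negb_or => /andP[qt pt] W'.
  rewrite inE => /orP[/eqP -> _|]; last exact: qP.
  apply: contra pt => /submxP[D]; rewrite /root -pE => ->.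
  rewrite /c -mulmxA colE (mulmxA W) mulmx_coker mul0mx.
  by rewrite mulmx0 mxE.
have [t /andP[t0 t1] qt] := small_nonroot q0.
exists (v t); split => [j|W]; last exact: qP.
rewrite mxE addrAC subrr add0r normrM (gtr0_norm e0) ger_pMr//.
by rewrite normrX ger0_norm// exprn_ile1.
Qed.

(** The vertices are chosen one at a time. The first avoids every proper W; the others are in
    general position both to each W and to each W + v0. A relation modulo W that involves v0 is a
    relation of the others modulo W + v0: the support loses one element while the rank grows by at
    most one. *)
Lemma general_position (R : realType) (N k : nat) (Ws : seq 'M[R]_(N + 1))
    (w : 'I_k -> 'rV[R]_N) (e : R) : 0 < e ->
  exists v : 'I_k -> 'rV[R]_N, (forall i j, `|v i 0 j - w i 0 j| <= e) /\
    forall W, W \in Ws -> forall a : 'I_k -> R,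
      (#|[set i | a i != 0%R]%SET| + \rank W <= N + 1)%N ->
      ((\sum_i a i *: homog (v i))%R <= W)%MS -> forall i, a i = 0.
Proof.
move=> e0; elim: k Ws w => [|k IH] Ws w.
  by exists (fun=> 0); split => [[]//|W _ a _ _ []].
have [v0 [v0w v0W]] := avoid_subspaces Ws (w ord0) e0.
pose hv0 := homog v0.
pose add (W : 'M[R]_(N + 1)) : 'M[R]_(N + 1) := (W + hv0)%MS.
have [v [vw vW]] := IH (Ws ++ map add Ws) (fun i => w (lift ord0 i)).
exists (fun i => if unlift ord0 i is Some j then v j else v0).
split=> [i j|W WWs a cardS].
  case: unliftP => [i' ->|->]; [exact: vw|exact: v0w].
rewrite big_ord_recl unlift_none -/hv0.
under eq_bigr do rewrite liftK.
set s := \sum_(i < k) _ => subW.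
have cardE : #|[set i | a i != 0%R]%SET| =
    ((a ord0 != 0%R) + #|[set i | a (lift ord0 i) != 0%R]%SET|)%N.
  rewrite -!sum1_card !big_mkcond /= big_ord_recl /= inE; congr addn.
  by rewrite [RHS]big_mkcond; apply: eq_bigr => i _; rewrite !inE.
have [a0|a0] := eqVneq (a ord0) 0.
  move=> i; case: (unliftP ord0 i) => [j ->|-> //].
  apply: (vW W _ (fun j => a (lift ord0 j))).
  - by rewrite mem_cat WWs.
  - by move: cardS; rewrite cardE a0 eqxx.
  - by move: subW; rewrite a0 scale0r add0r.
move: cardS; rewrite cardE a0 add1n => cardS.
have al j : a (lift ord0 j) = 0.
  apply: (vW (add W) _ (fun j => a (lift ord0 j))).
  - by rewrite mem_cat (map_f add) ?orbT.
  - apply: leq_trans cardS; rewrite addSnnS leq_add2l.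
    apply: (leq_trans (mxrank_adds_leqif _ _)).
    by rewrite -[(\rank W).+1]addn1 leq_add2l rank_leq_row.
  - have -> : \sum_(i < k) a (lift ord0 i) *: homog (v i) =
        (a ord0 *: hv0 + s) - a ord0 *: hv0 by rewrite addrAC subrr add0r.
    apply: addmx_sub; first exact: submx_trans subW (addsmxSl _ _).
    by rewrite eqmx_opp; apply: submx_trans (scalemx_sub _ (submx_refl _))
      (addsmxSr _ _).
(* Only the term of [v0] is left, so [v0] would lie in the proper subspace [W]. *)
have s0 : s = 0 by rewrite /s big1// => j _; rewrite al scale0r.
have rW : (\rank W < N + 1)%N.
  by apply: leq_trans cardS; rewrite addSn ltnS leq_addl.
have /negP[] := v0W W WWs rW.
move: subW; rewrite s0 addr0.
by move=> /(scalemx_sub (a ord0)^-1); rewrite scalerA mulVf// scale1r.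
Qed.

Lemma homog_affine (R : realType) (N k : nat) (a : 'I_k -> R)
    (v : 'I_k -> 'rV[R]_N) : \sum_i a i = 1 ->
  homog (\sum_i a i *: v i) = \sum_i a i *: homog (v i).
Proof.
move=> a1; apply/rowP => j; rewrite summxE.
under [RHS]eq_bigr do rewrite mxE.
rewrite /homog; case: (split_ordP j) => j' ->.
  by rewrite row_mxEl summxE; apply: eq_bigr => i _; rewrite mxE row_mxEl.
rewrite row_mxEr ord1 mxE eqxx -[1%:R]a1; apply: eq_bigr => i _.
by rewrite row_mxEr mxE mulr1.
Qed.

(** The affine hull of a simplex in homogeneous coordinates. The brackets make the matrix square, so
    that spans of all dimensions share one type. *)
Definition span_at (R : realType) (N k : nat) (v : 'I_k -> 'rV[R]_N)
    (S : {set 'I_k}) : 'M[R]_(N + 1) :=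
  (<<\matrix_(i < #|S|) homog (v (enum_val i))>>)%MS.

Lemma rank_span_at (R : realType) (N k : nat) (v : 'I_k -> 'rV[R]_N)
    (S : {set 'I_k}) : (\rank (span_at v S) <= #|S|)%N.
Proof. by rewrite mxrank_gen rank_leq_row. Qed.

Lemma homog_span_at (R : realType) (N k : nat) (v : 'I_k -> 'rV[R]_N)
    (S : {set 'I_k}) i : i \in S -> (homog (v i) <= span_at v S)%MS.
Proof.
move=> iS; rewrite genmxE -(enum_rankK_in iS iS).
by rewrite -[X in (X <= _)%MS](rowK (fun i => homog (v (enum_val i)))) row_sub.
Qed.

(** Reindexing of rows, written on flattened matrices in homogeneous coordinates. For h(i) = i mod n
    it extends a block of length n periodically to length m. *)
Definition pullback_mx (R : realType) (d m n : nat) (h : 'I_m -> 'I_n) :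
    'M[R]_(n * d + 1, m * d + 1) :=
  block_mx
    (lin1_mx (mxvec \o (rowsub h : 'M[R]_(n, d) -> 'M[R]_(m, d)) \o vec_mx))
    0 0 1.

Lemma homog_pullback (R : realType) (d m n : nat) (h : 'I_m -> 'I_n)
    (A : 'M[R]_(n, d)) :
  homog (mxvec (rowsub h A)) = homog (mxvec A) *m pullback_mx R d h.
Proof.
rewrite /homog mul_row_block !mulmx0 addr0 add0r mulmx1.
by rewrite mul_rV_lin1 /= mxvecK.
Qed.

Definition pullback_space (R : realType) (d m n : nat) (h : 'I_m -> 'I_n)
    (V : 'M[R]_(n * d + 1)) : 'M[R]_(m * d + 1) :=
  (<<V *m pullback_mx R d h>>)%MS.

Lemma rank_pullback_space (R : realType) (d m n : nat) (h : 'I_m -> 'I_n)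
    (V : 'M[R]_(n * d + 1)) : (\rank (pullback_space h V) <= \rank V)%N.
Proof. by rewrite mxrank_gen mxrankM_maxl. Qed.

Lemma homog_pullback_space (R : realType) (d m n : nat) (h : 'I_m -> 'I_n)
    (V : 'M[R]_(n * d + 1)) (A : 'M[R]_(n, d)) :
  (homog (mxvec A) <= V)%MS ->
  (homog (mxvec (rowsub h A)) <= pullback_space h V)%MS.
Proof. by move=> AV; rewrite genmxE homog_pullback submxMr. Qed.

(** * Metrizable spaces and topological dimension *)

Definition is_dist (R : realType) (X : topologicalType) (dist : X -> X -> R) :=
  [/\ forall x, dist x x = 0,
      forall x y, dist x y = 0 -> x = y,
      forall x y, dist x y = dist y x,
      forall y x z, dist x z <= dist x y + dist y z &
      forall A : set X, open A <->
        forall x, A x -> exists2 e : R, 0 < e & [set y | dist x y < e] `<=` A].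

Lemma dist_ge0 (R : realType) (X : topologicalType) (dist : X -> X -> R) x y :
  is_dist dist -> 0 <= dist x y.
Proof.
move=> [d0 _ ds dt _]; have := dt y x x.
by rewrite d0 (ds y x) -mulr2n pmulrn_lge0.
Qed.

Lemma open_dist_ball (R : realType) (X : topologicalType) (dist : X -> X -> R)
  x e : is_dist dist -> open [set y | dist x y < e].
Proof.
move=> [d0 _ ds dt dopen]; apply/dopen => y /= xy.
exists (e - dist x y); rewrite ?subr_gt0// => z /= yz.
by apply: (le_lt_trans (dt y x z)); lra.
Qed.

Lemma nbhs_dist_ball (R : realType) (X : topologicalType) (dist : X -> X -> R)
  x e : is_dist dist -> 0 < e -> nbhs x [set y | dist x y < e].
Proof.
move=> dP e0; apply: open_nbhs_nbhs; split; first exact: open_dist_ball.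
by case: dP => /= ->.
Qed.

Lemma nbhs_distP (R : realType) (X : topologicalType) (dist : X -> X -> R)
    x (A : set X) : is_dist dist -> nbhs x A ->
  exists2 e : R, 0 < e & [set y | dist x y < e] `<=` A.
Proof.
move=> dP; rewrite nbhsE => -[B [oB Bx] BA]; case: (dP) => _ _ _ _ /(_ B)[H _].
by have [e e0 eB] := H oB x Bx; exists e => // y /eB/BA.
Qed.

(* The distance to the complement, truncated at 1 in case [O] is everything. *)
Lemma metrizable_bump (R : realType) (X : topologicalType) (O : set X) :
  metrizable R X -> open O ->
  exists r : X -> R, [/\ continuous r, forall z, 0 <= r z &
    forall z, 0 < r z <-> O z].
Proof.
move=> [dist dP] oO; have dge := dist_ge0 _ _ dP.
case: (dP) => d0 deq ds dt dopen.
pose S z : set R := 1 |` [set dist z y | y in ~` O].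
have S0 z : S z !=set0 by exists 1; left.
have Slb z : lbound (S z) 0 by move=> s [->|[y _ <-]].
have hinf z : has_inf (S z) by split; [exact: S0|exists 0; exact: Slb].
have infS z s : S z s -> inf (S z) <= s.
  by move=> Ss; apply: ge_inf => //; case: (hinf z).
have lip x y : inf (S x) - dist x y <= inf (S y).
  apply: lb_le_inf => // s [->|[u Ou <-]].
    by rewrite lerBlDr; apply: (le_trans (infS x 1 _)); [left|rewrite lerDl].
  rewrite lerBlDl; apply: le_trans (dt y x u); apply: infS.
  by right; exists u.
exists (fun z => inf (S z)); split.
- move=> x; apply/cvgrPdist_lt => e e0.
  apply: filterS (nbhs_dist_ball x dP e0) => y /= xy.
  apply: le_lt_trans xy; rewrite ler_norml.
  by have := lip x y; have := lip y x; rewrite (ds y x); lra.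
- by move=> z; apply: lb_le_inf.
- move=> z; split => [r0|Oz].
    apply: contrapT => nO; have : inf (S z) <= 0.
      by apply: infS; right; exists z.
    by rewrite leNgt r0.
  have [e e0 eO] := (dopen O).1 oO z Oz.
  apply: (@lt_le_trans _ _ (Num.min 1 e)); first by rewrite lt_min ltr01.
  apply: lb_le_inf => // s [->|[u Ou <-]]; first by rewrite ge_min lexx.
  rewrite ge_min orbC leNgt; apply/orP; left.
  by apply/negP => zu; apply: Ou; apply: eO.
Qed.

Lemma compact_open_cover (X : topologicalType) (G : X -> set X) :
  compact [set: X] -> (forall x, open (G x)) -> (forall x, G x x) ->
  exists s : seq X, forall z, exists2 c, c \in s & G c z.
Proof.
(* The cover form of compactness is applied to a pointed copy of [X], hence the separate empty
   case. *)
move=> Xc oG Gx; have [[x0 _]|X0] := pselect ([set: X] !=set0); last first.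
  by exists [::] => z; case: X0; exists z.
pose X' : ptopologicalType := HB.pack X (isPointed.Build X x0).
have cX : @cover_compact X' setT by rewrite -compact_cover; exact: Xc.
have [|z _|D' _ cov] := cX X setT G; first by move=> i _; exact: oG.
  by exists z => //; exact: Gx.
exists D' => z; have [c cD Gc] := cov z I.
by exists c.
Qed.

Lemma topdim_lt_refinement (R : realType) (Y : topologicalType)
    (alpha : {fset (set Y)}) (r : R) :
  open_cover alpha -> (topdim R Y < r%:E)%E ->
  exists2 beta : {fset (set Y)}, open_cover beta /\ refines beta alpha &
    forall y, (\sum_(U <- beta) (y \in U))%:R - 1 < r.
Proof.
move=> ca; rewrite /topdim; case: ifPn => [/eqP Y0 _|_ tr].
  exists alpha; first by split => // V Va; exists V.
  by move=> y; have : [set: Y] y by []; rewrite Y0.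
have : (cover_dim R alpha < r%:E)%E.
  by apply: le_lt_trans tr; apply: ereal_sup_ubound; exists alpha.
move=> /ereal_inf_lt[_ [beta [cb rb] <-] br].
exists beta => // y; rewrite -lte_fin; apply: le_lt_trans br.
rewrite /cover_ord EFinB; apply: leeB => //.
apply: ereal_sup_ubound; exists y => //; congr EFin.
by rewrite natr_sum; apply: eq_bigr => U _; rewrite indicE.
Qed.

(** The hypothesis on [perdim] enters only through this bound: half the dimension of the space
    R^(nd) that contains the orbit matrices of length n. *)
Lemma perdim_topdim (R : realType) (X : topologicalType) (T : homeo X X)
    (d n : nat) : (perdim T R < (d%:R / 2)%:E)%E -> (0 < n)%N ->
  (topdim R (set_type (periodic_upto T n)) < ((n * d)%:R / 2)%:E)%E.
Proof.
move=> pd n0; have n0R : (0 : R) < n%:R by rewrite ltr0n.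
have : (topdim R (set_type (periodic_upto T n)) * (n%:R^-1)%:E <
    (d%:R / 2)%:E)%E.
  by apply: le_lt_trans pd; apply: ereal_sup_ubound; exists n.
rewrite lte_pdivrMr// -EFinM => /lt_le_trans; apply.
by rewrite lee_fin natrM; lra.
Qed.

(** A finite cover of X by sets of small oscillation is traced on P, refined there with small
    multiplicity, and the refinement is extended to open sets of X. *)
Lemma fine_open_cover (R : realType) (X : topologicalType) (P : set X)
    (n d N : nat) (F : 'I_n -> X -> 'rV[R]_d) (e : R) :
  compact [set: X] -> (forall j, continuous (F j)) -> 0 < e ->
  (topdim R (set_type P) < (N%:R / 2)%:E)%E ->
  exists k (O : 'I_k -> set X) (c : 'I_k -> X),
    [/\ forall i, open (O i),
        forall i z, O i z -> forall j, `|F j (c i) - F j z| < e,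
        forall y, P y -> exists i, O i y &
        forall y, P y -> (2 * #|[set i | y \in O i]%SET| <= N + 1)%N].
Proof.
move=> Xc cF e0 dimP.
pose D (c : X) : set X := [set z | forall j, `|F j c - F j z| < e].
have nD c : nbhs c (D c).
  have : forall j, \forall z \near c, `|F j c - F j z| < e.
    by move=> j; move/cvgrPdist_lt : (cF j c); apply.
  exact: filter_forall.
pose G c := interior (D c).
have [||s sG] := @compact_open_cover X G Xc.
- by move=> x; exact: open_interior.
- by move=> x; exact: nD.
pose alpha : {fset set (set_type P)} :=
  [fset (set_val @^-1` G c : set (set_type P)) | c in s]%fset.
have [|beta [[ob cb] rb] mb] := topdim_lt_refinement (alpha := alpha) _ dimP.
  split=> [U /imfsetP[c _ ->]|y].
    by exists (G c) => //; exact: open_interior.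
  have [c cs Gc] := sG (set_val y).
  by exists (set_val @^-1` G c) => //; apply/imfsetP; exists c.
have pick_ (i : 'I_(size beta)) : exists p : set X * X,
    [/\ open p.1, set_val @^-1` p.1 = nth set0 beta i &
      nth set0 beta i `<=` set_val @^-1` G p.2].
  have ib : nth set0 beta i \in beta by apply: mem_nth.
  have [B oB BE] := ob _ ib.
  have [U /imfsetP[c _ ->] Vc] := rb _ ib.
  by exists (B, c).
have [p pP] := choice pick_.
(* An arbitrary open extension controls nothing off [P]; cutting by [G] restores the oscillation
   bound and leaves the trace on [P] unchanged. *)
pose O i := (p i).1 `&` G (p i).2.
have OE y (Py : P y) i : O i y <-> nth set0 beta i (SigSub (mem_set Py)).
  have [_ pE pG] := pP i; rewrite -pE; split => [[]//|/= py]; split => //.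
  have := pG (SigSub (mem_set Py)); apply.
  by rewrite -pE.
exists (size beta), O, (fun i => (p i).2); split.
- by move=> i; apply: openI; [case: (pP i)|exact: open_interior].
- by move=> i z [_ /interior_subset]; exact.
- move=> y Py; have [U Ub Uy] := cb (SigSub (mem_set Py)).
  have iU : (index U beta < size beta)%N by rewrite index_mem.
  by exists (Ordinal iU); apply/(OE y Py); rewrite nth_index.
- move=> y Py; have := mb (SigSub (mem_set Py)).
  rewrite (big_nth set0) big_mkord.
  have -> : (\sum_(i < size beta) (SigSub (mem_set Py) \in nth set0 beta i) =
      #|[set i | y \in O i]%SET|)%N.
    rewrite -sum1_card [RHS]big_mkcond; apply: eq_bigr => i _.
    rewrite inE.
    have -> : (SigSub (mem_set Py) \in nth set0 beta i) = (y \in O i).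
      by apply/idP/idP; rewrite !inE => /(OE y Py).
    by case: (y \in O i).
  set m := #|_| => mN.
  (* The order bound m - 1 < N/2 is 2m < N + 2, which for integers is 2m <= N + 1. *)
  suff : (2 * m < N + 2)%N by rewrite addn2 addn1 ltnS.
  by rewrite -(ltr_nat R) natrM natrD; move: mN; lra.
Qed.

(** * Perturbation along periodic orbits *)

Lemma rV_norm_le (R : realType) (d : nat) (v : 'rV[R]_d) (e : R) :
  0 <= e -> (forall j, `|v 0 j| <= e) -> `|v| <= e.
Proof.
move=> e0 ve; rewrite /Num.norm /= mx_normrE.
by apply/bigmax_leP; split => // -[i j] _ /=; rewrite ord1.
Qed.

Lemma rV_coord_le (R : realType) (d : nat) (v : 'rV[R]_d) j : `|v 0 j| <= `|v|.
Proof.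
by rewrite [leRHS]/Num.norm /= mx_normrE (le_bigmax _ _ (0, j)).
Qed.

Lemma continuous_sum (R : realType) (V : normedModType R) (X : topologicalType)
    (I : Type) (s : seq I) (F : I -> X -> V) :
  (forall i, continuous (F i)) -> continuous (fun z => \sum_(i <- s) F i z).
Proof.
move=> cF; elim: s => [|i s IH] z.
  by under eq_fun do rewrite big_nil; exact: cvg_cst.
under eq_fun do rewrite big_cons.
by apply: cvgD; [exact: cF|exact: IH].
Qed.

Section homeo_iterates.
Variables (X : topologicalType) (T : homeo X X).

Lemma iter_homeoK j : cancel (iter j (homeo_inv T)) (iter j T).
Proof.
by elim: j => // j IH z; rewrite iterSr iterS homeo_invK IH.
Qed.

Lemma iter_homeo_invK j : cancel (iter j T) (iter j (homeo_inv T)).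
Proof.
by elim: j => // j IH z; rewrite iterSr iterS homeo_funK IH.
Qed.

Lemma continuous_iter (f : X -> X) j : continuous f -> continuous (iter j f).
Proof.
move=> cf; elim: j => [|j IH] x; first exact: cvg_id.
by apply: (continuous_comp (IH x)); exact: cf.
Qed.

Lemma iter_modn (n i : nat) (x : X) :
  iter n T x = x -> iter (i %% n)%N T x = iter i T x.
Proof.
move=> nx; rewrite [in RHS](divn_eq i n) addnC iterD; congr iter.
by elim: (i %/ n)%N => // q IH; rewrite mulSn iterD -IH nx.
Qed.

Lemma periodic_upto_fixed n x : (0 < n)%N -> iter n T x = x ->
  periodic_upto T n x.
Proof.
move=> n0 nx.
have ex : exists m, (0 < m)%N && (iter m T x == x).
  by exists n; rewrite n0 nx eqxx.
case: (ex_minnP ex) => m /andP[m0 /eqP mx] minm.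
exists m; first by apply: minm; rewrite n0 nx eqxx.
split => // l /andP[l0 lm] lx.
by have := minm l; rewrite l0 lx eqxx => /(_ isT); rewrite leqNgt lm.
Qed.

End homeo_iterates.

(** Kept as a matrix so that time shifts act by [rowsub]; [mxvec] turns it into a point of
    R^(nd). *)
Definition orbit_mx (R : realType) (X : Type) (d n : nat) (T : X -> X)
    (g : X -> 'rV[R]_d) (x : X) : 'M[R]_(n, d) :=
  \matrix_(i, j) g (iter i T x) 0 j.

(** The bump functions of the O i are normalised together with one more, positive exactly off A. The
    common denominator is then positive everywhere, and on A the extra function contributes
    nothing. *)
Lemma partition_on_closed (R : realType) (X : topologicalType) (k : nat)
    (O : 'I_k -> set X) (A : set X) :
  metrizable R X -> (forall i, open (O i)) -> closed A ->
  (forall x, A x -> exists i, O i x) ->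
  exists psi : 'I_k -> X -> R,
    [/\ forall i, continuous (psi i), forall i z, 0 <= psi i z,
        forall i z, psi i z != 0 -> O i z, forall z, \sum_i psi i z <= 1 &
        forall x, A x -> \sum_i psi i x = 1].
Proof.
move=> Xm oO cA AO.
have [r rP] := choice (fun i => metrizable_bump Xm (oO i)).
have [rA [rAc rA0 rAP]] := metrizable_bump Xm (closed_openC cA).
pose den z := \sum_i r i z + rA z.
have sr0 z : 0 <= \sum_i r i z by apply: sumr_ge0 => i _; case: (rP i).
have den0 z : 0 < den z.
  have [Az|nAz] := pselect (A z); last first.
    by apply: ltr_wpDl => //; apply/rAP.
  have [i Oi] := AO z Az; apply: ltr_wpDr => //.
  rewrite (bigD1 i)//=; apply: ltr_wpDr.
    by apply: sumr_ge0 => j _; case: (rP j).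
  by case: (rP i) => _ _ /(_ z) ->.
have rc i : continuous (r i) by case: (rP i).
exists (fun i z => r i z / den z); split.
- move=> i z; apply: cvgM; first exact: rc.
  apply: cvgV; first by rewrite gt_eqF.
  apply: cvgD; last exact: rAc.
  by apply: (@continuous_sum R R^o) => j; exact: rc.
- by move=> i z; apply: divr_ge0; [case: (rP i)|exact: ltW].
- move=> i z; rewrite mulf_eq0 invr_eq0 negb_or => /andP[ri _].
  by case: (rP i) => _ r0 rO; apply/rO; rewrite lt_neqAle eq_sym ri r0.
- by move=> z; rewrite -mulr_suml ler_pdivrMr// mul1r lerDl.
- move=> x Ax; rewrite -mulr_suml; have -> : \sum_i r i x = den x.
    rewrite /den; suff -> : rA x = 0 by rewrite addr0.
    by apply/eqP; rewrite eq_le rA0 andbT leNgt; apply/negP => /rAP; apply.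
  by rewrite divff// gt_eqF.
Qed.

(** The sets O, T O, ..., T^(n-1) O are pairwise disjoint, so a map can be altered on each of them
    independently. *)
Definition orbit_disjoint (X : Type) (T : X -> X) (n : nat) (O : set X) :=
  forall i j : nat, (i < n)%N -> (j < n)%N -> forall y z, O y -> O z ->
    iter i T y = iter j T z -> i = j.

Section spread.
Variables (R : realType) (X : topologicalType) (T : homeo X X).
Variables (d n k : nat) (f : X -> 'rV[R]_d) (psi : 'I_k -> X -> R).
Variable u : 'I_k -> 'M[R]_(n, d).

(** For z = T^j y with y in a set O supporting the weights and satisfying [orbit_disjoint], only the
    j-th summand survives: f z is pulled towards the j-th rows of the u i with weights psi i y.
    Where the weights sum to 1, f cancels and the orbit matrix of y is the convex combination of the
    u i. *)
Definition spread (z : X) : 'rV[R]_d :=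
  f z + \sum_(j < n) \sum_(i < k)
    psi i (iter j (homeo_inv T) z) *: (row j (u i) - f z).

Lemma continuous_spread : continuous f -> (forall i, continuous (psi i)) ->
  continuous spread.
Proof.
move=> cf cpsi z; apply: cvgD; first exact: cf.
apply: (@continuous_sum R) => j; apply: continuous_sum => i y.
apply: cvgZ; last by apply: cvgB; [exact: cvg_cst|exact: cf].
apply: continuous_comp; last exact: cpsi.
by apply: continuous_iter; exact: homeo_inv_continuous.
Qed.

Variable O : set X.
Hypothesis psiO : forall i z, psi i z != 0 -> O z.
Hypothesis disj : orbit_disjoint T n O.

Lemma spread_out z : (forall j y, (j < n)%N -> O y -> iter j T y <> z) ->
  spread z = f z.
Proof.
move=> zO; rewrite /spread big1 ?addr0// => j _; rewrite big1// => i _.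
have [->|/psiO Oz] := eqVneq (psi i (iter j (homeo_inv T) z)) 0.
  by rewrite scale0r.
by have := zO j _ (ltn_ord j) Oz; rewrite iter_homeoK.
Qed.

Lemma spread_in (j : 'I_n) y : O y -> spread (iter j T y) =
  f (iter j T y) + \sum_i psi i y *: (row j (u i) - f (iter j T y)).
Proof.
move=> Oy; rewrite /spread (bigD1 j)//= iter_homeo_invK [X in _ + (_ + X)]big1.
  by rewrite addr0.
move=> l lj; rewrite big1// => i _.
set y' := iter l _ _; have [->|/psiO Oy'] := eqVneq (psi i y') 0.
  by rewrite scale0r.
have /val_inj lj' : nat_of_ord l = j.
  by apply: (disj (ltn_ord l) (ltn_ord j) Oy' Oy); rewrite iter_homeoK.
by rewrite lj' eqxx in lj.
Qed.

Lemma orbit_mx_spread y : O y -> \sum_i psi i y = 1 ->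
  orbit_mx n T spread y = \sum_i psi i y *: u i.
Proof.
move=> Oy psi1; apply/matrixP => j l; rewrite mxE spread_in//.
under eq_bigr do rewrite scalerBr.
rewrite sumrB -scaler_suml psi1 scale1r addrC subrK.
by rewrite !summxE; apply: eq_bigr => i _; rewrite !mxE.
Qed.

Lemma spread_close (e : R) : 0 <= e -> (forall i z, 0 <= psi i z) ->
  (forall z, \sum_i psi i z <= 1) ->
  (forall i z, psi i z != 0 ->
    forall j : 'I_n, `|row j (u i) - f (iter j T z)| <= e) ->
  forall z, `|spread z - f z| <= e.
Proof.
move=> e0 psi0 psi1 psie z.
have [[j [y [jn [Oy <-]]]]|nO] :=
    pselect (exists j y, (j < n)%N /\ O y /\ iter j T y = z).
  rewrite (spread_in (Ordinal jn) Oy) /= addrAC subrr add0r.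
  apply: le_trans (ler_norm_sum _ _ _) _.
  apply: (@le_trans _ _ (\sum_i psi i y * e)); last first.
    by rewrite -mulr_suml ler_piMl.
  apply: ler_sum => i _; rewrite normrZ ger0_norm//.
  have [->|pi] := eqVneq (psi i y) 0; first by rewrite !mul0r.
  by apply: ler_wpM2l => //; exact: (psie i y pi (Ordinal jn)).
rewrite spread_out ?subrr ?normr0// => j y jn Oy jz; apply: nO.
by exists j, y.
Qed.

End spread.

(** The map is pushed into the nerve of a fine cover, realised in R^(nd) with vertices close to
    orbit matrices of f and in general position to [Ws]. The list [Vs] consists of the spans of the
    small simplices. *)
Lemma orbit_perturbation (R : realType) (X : topologicalType) (T : homeo X X)
    (d n : nat) (O A : set X) (f : X -> 'rV[R]_d) (e : R)
    (Ws : seq 'M[R]_(n * d + 1)) :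
  compact [set: X] -> metrizable R X -> (0 < n)%N ->
  (topdim R (set_type (periodic_upto T n)) < ((n * d)%:R / 2)%:E)%E ->
  open O -> closed A -> A `<=` O -> (forall x, A x -> iter n T x = x) ->
  orbit_disjoint T n O -> continuous f -> 0 < e ->
  (forall W, W \in Ws -> (2 * \rank W <= n * d + 2)%N) ->
  exists g : X -> 'rV[R]_d,
    [/\ continuous g, forall z, `|g z - f z| <= e,
      forall z, (forall j y, (j < n)%N -> O y -> iter j T y <> z) -> g z = f z &
      exists Vs : seq 'M[R]_(n * d + 1),
        (forall V, V \in Vs -> (2 * \rank V <= n * d + 1)%N) /\
        forall x, A x ->
          (exists2 V, V \in Vs & (homog (mxvec (orbit_mx n T g x)) <= V)%MS) /\
          (forall W, W \in Ws ->
             ~~ (homog (mxvec (orbit_mx n T g x)) <= W)%MS)].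
Proof.
move=> Xc Xm n0 dimP oO cA AO Afix disj cf e0 rWs.
(* One half pays for the oscillation of [f] on the cover, the other for moving the vertices. *)
have e20 : 0 < e / 2 by rewrite divr_gt0.
have AP x : A x -> periodic_upto T n x.
  by move=> /Afix; exact: periodic_upto_fixed.
have [|k [O' [c [oO' osc cov mult]]]] := fine_open_cover
  (F := fun (j : 'I_n) z => f (iter j T z)) Xc _ e20 dimP.
  move=> j z; apply: continuous_comp; last exact: cf.
  by apply: continuous_iter; exact: homeo_fun_continuous.
have [v [vw vW]] := general_position Ws
  (fun i => mxvec (orbit_mx n T f (c i))) e20.
have [||psi [psic psi0 psiO psi1 psiA]] := partition_on_closed (R := R)
  (O := fun i => O' i `&` O) Xm _ cA.
- by move=> i; exact: openI.
- move=> x Ax; have [i Oi] := cov x (AP x Ax).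
  by exists i; split => //; exact: AO.
pose u i : 'M_(n, d) := vec_mx (v i).
have psiO1 i z : psi i z != 0 -> O z by move=> /psiO[].
exists (spread T f psi u); split.
- exact: continuous_spread.
- apply: (spread_close psiO1 disj) => //; first exact: ltW.
  move=> i z /psiO[Oi _] j.
  have -> : row j (u i) - f (iter j T z) = (row j (u i) - f (iter j T (c i))) +
      (f (iter j T (c i)) - f (iter j T z)) by rewrite addrA subrK.
  apply: le_trans (ler_normD _ _) _; rewrite [leRHS](splitr e); apply: lerD.
    apply: rV_norm_le => [|l]; first exact: ltW.
    have := vw i (mxvec_index j l); rewrite mxvecE.
    by rewrite !mxE.
  by apply: ltW; exact: (osc i z Oi j).
- exact: spread_out.
pose S x := [set i | x \in O' i]%SET.
(* The multiplicity bound puts the simplex [S x] of every x in [A] in this list. *)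
exists [seq span_at v s | s <- [seq s : {set 'I_k} <- enum {: {set 'I_k}} |
  (2 * #|s| <= n * d + 1)%N]].
split.
  move=> V /mapP[s]; rewrite mem_filter => /andP[cs _] ->.
  by apply: leq_trans cs; rewrite leq_mul2l rank_span_at.
move=> x Ax.
have supp i : psi i x != 0 -> i \in S x.
  by move=> /psiO[Oi _]; rewrite inE; apply/mem_set.
have -> : homog (mxvec (orbit_mx n T (spread T f psi u) x)) =
    \sum_i psi i x *: homog (v i).
  rewrite -homog_affine ?psiA//.
  rewrite (orbit_mx_spread _ _ psiO1 disj) ?psiA//; last exact: AO.
  rewrite linear_sum; congr homog; apply: eq_bigr => i _.
  by rewrite linearZ /= vec_mxK.
have cS := mult x (AP x Ax).
split.
  exists (span_at v (S x)).
    by apply: map_f; rewrite mem_filter cS mem_enum.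
  apply: summx_sub => i _; have [->|/supp iS] := eqVneq (psi i x) 0.
    by rewrite scale0r sub0mx.
  by apply: scalemx_sub; exact: homog_span_at.
move=> W WWs; apply/negP => subW.
(* From 2|S x| <= nd + 1 and 2 rank W <= nd + 2 the sum |S x| + rank W is at most nd + 3/2, hence at
   most nd + 1, as general position requires. *)
have all0 : forall i, psi i x = 0.
  apply: (vW W WWs (fun i => psi i x) _ subW).
  have c1 : (#|[set i | psi i x != 0%R]%SET| <= #|S x|)%N.
    by apply/subset_leq_card/fintype.subsetP => i; rewrite inE => /supp.
  have := rWs W WWs; move: c1 cS; rewrite /S.
  set a := #|_|; set b := #|_|; set r := \rank W; set nd := (n * d)%N.
  lia.
have := psiA x Ax; rewrite big1 => [/esym/eqP|//].
by rewrite oner_eq0.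
Qed.

Definition separates (R : realType) (X : topologicalType) (T : X -> X) (d : nat)
    (K : set (X * X)) (g : X -> 'rV[R]_d) :=
  forall p, K p -> exists i, g (iter i T p.1) <> g (iter i T p.2).

(** If x and T^q x were not told apart before time n, the orbit matrix of x would be q-periodic,
    hence in the pullback of all of R^(qd). Since q is a proper divisor of n, that space is small
    enough to be avoided. *)
Lemma same_orbit_perturbation (R : realType) (X : topologicalType)
    (T : homeo X X) (d n q : nat) (O A : set X) (f : X -> 'rV[R]_d) (e : R) :
  compact [set: X] -> metrizable R X -> (perdim T R < (d%:R / 2)%:E)%E ->
  (0 < q)%N -> (q < n)%N -> (q %| n)%N ->
  open O -> closed A -> A `<=` O -> (forall x, A x -> iter n T x = x) ->
  orbit_disjoint T n O -> continuous f -> 0 < e ->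
  exists g : X -> 'rV[R]_d, [/\ continuous g, forall z, `|g z - f z| <= e &
    forall x, A x -> exists2 i, (i < n)%N &
      g (iter i T x) <> g (iter i T (iter q T x))].
Proof.
move=> Xc Xm pd q0 qn qdvd oO cA AO Afix disj cf e0.
have n0 : (0 < n)%N by apply: ltn_trans qn.
pose h (i : 'I_n) : 'I_q := Ordinal (ltn_pmod i q0).
have [|g [cg gf _ [Vs [_ gA]]]] := orbit_perturbation
  (Ws := [:: pullback_space (d := d) h 1%:M])
  Xc Xm n0 (perdim_topdim pd n0) oO cA AO Afix disj cf e0.
  move=> W; rewrite inE => /eqP ->.
  have rW : (\rank (pullback_space (d := d) h (1%:M : 'M[R]_(q * d + 1))) <=
      q * d + 1)%N.
    by apply: leq_trans (rank_pullback_space _ _) _; rewrite mxrank1.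
  have q2 : (2 * q <= n)%N.
    move/dvdnP : qdvd qn => [[|[|a]]]; rewrite ?mul0n ?mul1n => ->.
    - by [].
    - by rewrite ltnn.
    - by move=> _; rewrite leq_mul2r orbT.
  (* With 2q <= n, the quantity 2(qd + 1) just meets the admissible bound nd + 2. *)
  apply: (@leq_trans (2 * (q * d + 1))); first by rewrite leq_mul2l.
  by rewrite mulnDr muln1 leq_add2r mulnA leq_mul2r q2 orbT.
exists g; split => // x Ax; apply: contrapT => nosep.
have per i : (i < n)%N -> g (iter i T x) = g (iter (i + q) T x).
  move=> i_n; apply: contrapT => ne; apply: nosep; exists i => //.
  by rewrite -iterD.
have [_ /(_ _ (mem_head _ _))/negP[]] := gA x Ax.
have -> : orbit_mx n T g x = rowsub h (orbit_mx q T g x).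
  apply/matrixP => i j; rewrite !mxE /=; congr (_ _ _).
  suff H (a b : nat) : (a * q + b < n)%N ->
      g (iter (a * q + b) T x) = g (iter b T x).
    by rewrite [in LHS](divn_eq i q) H -?divn_eq.
  elim: a => // a IH; rewrite mulSn -addnA addnC => abn.
  by rewrite -per ?IH//; apply: leq_ltn_trans abn; exact: leq_addr.
by apply: homog_pullback_space; rewrite submx1.
Qed.

(** The map is perturbed first along O, then along O' so as to avoid the n-periodic extensions of
    the spans obtained first. If g agreed along the orbits of x and y up to time m, the orbit matrix
    of y would be such an extension of that of x. *)
Lemma distinct_orbits_perturbation (R : realType) (X : topologicalType)
    (T : homeo X X) (d n m : nat) (O A O' A' : set X) (f : X -> 'rV[R]_d)
    (e : R) :
  compact [set: X] -> metrizable R X -> (perdim T R < (d%:R / 2)%:E)%E ->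
  (0 < n)%N -> (n <= m)%N ->
  open O -> closed A -> A `<=` O -> (forall x, A x -> iter n T x = x) ->
  orbit_disjoint T n O ->
  open O' -> closed A' -> A' `<=` O' -> (forall x, A' x -> iter m T x = x) ->
  orbit_disjoint T m O' ->
  (forall i j, (i < n)%N -> (j < m)%N -> forall y z, O y -> O' z ->
    iter i T y <> iter j T z) ->
  continuous f -> 0 < e ->
  exists g : X -> 'rV[R]_d, [/\ continuous g, forall z, `|g z - f z| <= e &
    forall x y, A x -> A' y -> exists2 i, (i < m)%N &
      g (iter i T x) <> g (iter i T y)].
Proof.
move=> Xc Xm pd n0 nm oO cA AO Afix disj oO' cA' AO' Afix' disj' cross cf e0.
have m0 : (0 < m)%N by apply: leq_trans nm.
have e20 : 0 < e / 2 by rewrite divr_gt0.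
(* Nothing has to be avoided yet; only the small spans [Vs] are wanted. *)
have [//|g1 [cg1 g1f _ [Vs [rVs g1A]]]] := orbit_perturbation (Ws := [::])
  Xc Xm n0 (perdim_topdim pd n0) oO cA AO Afix disj cf e20.
pose h (i : 'I_m) : 'I_n := Ordinal (ltn_pmod i n0).
have [|g [cg gg1 gout [Us [_ gA]]]] := orbit_perturbation
  (Ws := [seq pullback_space (d := d) h V | V <- Vs])
  Xc Xm m0 (perdim_topdim pd m0) oO' cA' AO' Afix' disj' cg1 e20.
  move=> W /mapP[V VVs ->].
  apply: (@leq_trans (2 * \rank V)).
    by rewrite leq_mul2l rank_pullback_space.
  apply: leq_trans (rVs V VVs) _; rewrite addn2 addn1 ltnS.
  by apply: leqW; rewrite leq_mul2r nm orbT.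
exists g; split => // [z|x y Ax Ay].
  rewrite -(subrK (g1 z) (g z)) -addrA [leRHS](splitr e).
  by apply: le_trans (ler_normD _ _) _; apply: lerD; [exact: gg1|exact: g1f].
apply: contrapT => nosep.
have eqg i : (i < m)%N -> g (iter i T x) = g (iter i T y).
  by move=> im; apply: contrapT => ne; apply: nosep; exists i.
have [[V VVs xV] _] := g1A x Ax.
have [_ /(_ _ (map_f _ VVs))/negP[]] := gA y Ay.
have -> : orbit_mx m T g y = rowsub h (orbit_mx n T g1 x).
  apply/matrixP => i j; rewrite !mxE /= -eqg// iter_modn ?Afix//.
  (* The second perturbation leaves the orbit of x alone: its times reduce modulo n, and by [cross]
     the first n images of [O] miss the first m images of [O']. *)
  rewrite gout// => l z lm Oz /esym; rewrite -(iter_modn _ (Afix x Ax)).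
  by apply: cross => //; [exact: ltn_pmod|exact: AO].
exact: homog_pullback_space.
Qed.

(** * Robust separation and Baire category *)

Lemma separates_open (R : realType) (X : topologicalType) (T : X -> X)
    (d N : nat) (K : set (X * X)) (g : X -> 'rV[R]_d) :
  continuous T -> compact K -> continuous g ->
  (forall p, K p ->
    exists2 i, (i < N)%N & g (iter i T p.1) <> g (iter i T p.2)) ->
  exists2 e : R, 0 < e & forall g', (forall z, `|g' z - g z| <= e) ->
    separates T K g'.
Proof.
move=> cT cK cg gK.
(* A continuous function, positive on the compact [K], hence bounded below there by a positive
   minimum [h c]. *)
pose h (p : X * X) : R := \sum_(i < N) `|g (iter i T p.1) - g (iter i T p.2)|.
have ch : continuous h.
  apply: (@continuous_sum R R^o) => i p; apply: cvg_norm; apply: cvgB.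
    apply: (@continuous_comp _ _ _ fst (g \o iter i T)); first exact: cvg_fst.
    by apply: continuous_comp; [exact: continuous_iter|exact: cg].
  apply: (@continuous_comp _ _ _ snd (g \o iter i T)); first exact: cvg_snd.
  by apply: continuous_comp; [exact: continuous_iter|exact: cg].
have [K0|nK0] := pselect (K !=set0); last first.
  by exists 1 => // g' _ p Kp; case: nK0; exists p.
have [|c Kc hc] := compact_EVT_min K0 cK (f := h).
  exact: continuous_subspaceT.
have hc0 : 0 < h c.
  have [i iN gi] := gK c (set_mem Kc); rewrite /h (bigD1 (Ordinal iN))//=.
  rewrite ltr_pwDl ?sumr_ge0// normr_gt0 subr_eq0.
  exact/eqP.
(* If some [g'] this close failed to separate p, then h p <= 2N h(c) / (2N + 1) < h c. *)
exists (h c / (2 * N + 1)%:R); first by rewrite divr_gt0// ltr0n addn1.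
move=> g' gg' p Kp; apply: contrapT => nosep.
have eqg i : g' (iter i T p.1) = g' (iter i T p.2).
  by apply: contrapT => ne; apply: nosep; exists i.
have := hc p (mem_set Kp); apply/negP; rewrite -ltNge.
set e := _ / _ in gg'.
have e0 : 0 < e by rewrite divr_gt0// ltr0n addn1.
apply: (@le_lt_trans _ _ (\sum_(i < N) (2 * e))).
  apply: ler_sum => i _.
  have -> : g (iter i T p.1) - g (iter i T p.2) =
      (g' (iter i T p.2) - g (iter i T p.2)) -
      (g' (iter i T p.1) - g (iter i T p.1)).
    by rewrite eqg opprB [RHS]addrC addrA subrK.
  by apply: le_trans (ler_normB _ _) _; rewrite mulr2n mulrDl !mul1r lerD.
rewrite sumr_const card_ord -mulr_natl.
have -> : h c = e * (2 * N + 1)%:R by rewrite /e divfK// gt_eqF// ltr0n addn1.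
by rewrite natrD natrM; move: e0; lra.
Qed.

Lemma continuous_uniform_approx (R : realType) (X : topologicalType) (d : nat)
    (g : X -> 'rV[R]_d) :
  (forall e, 0 < e ->
    exists2 f : X -> 'rV[R]_d, continuous f & forall z, `|g z - f z| <= e) ->
  continuous g.
Proof.
move=> gf x; apply/cvgrPdist_lt => e e0.
have e30 : 0 < e / 3 by rewrite divr_gt0.
have [f cf fe] := gf _ e30.
move/cvgrPdist_lt : (cf x) => /(_ _ e30); apply: filterS => z fxz.
have -> : g x - g z = (g x - f x) + (f x - f z) + (f z - g z).
  by rewrite !addrA !subrK.
apply: le_lt_trans (ler_normD _ _) _.
have := ler_normD (g x - f x) (f x - f z).
by have := fe x; have := fe z; rewrite (distrC (g z)); move: fxz; lra.
Qed.

Lemma exists_inv_lt (R : realType) (e : R) : 0 < e ->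
  exists j : nat, j.+1%:R^-1 < e.
Proof.
move=> e0; exists (Num.bound e^-1).
rewrite invf_plt ?posrE ?ltr0n//.
apply: lt_trans (archi_boundP _) _; first by rewrite invr_ge0 ltW.
by rewrite ltr_nat.
Qed.

(** Nested closed balls, given by centre and radius, are built so that the j-th step enforces Q j.
    The centres converge uniformly, and the limit lies in all the balls. *)
Lemma baire_continuous (R : realType) (X : topologicalType) (d : nat)
    (Q : nat -> (X -> 'rV[R]_d) -> Prop) :
  (forall j (f : X -> 'rV[R]_d) (e : R), continuous f -> 0 < e ->
    exists g : X -> 'rV[R]_d,
    [/\ continuous g, forall z, `|g z - f z| <= e &
      exists2 e', 0 < e' &
        forall g', (forall z, `|g' z - g z| <= e') -> Q j g']) ->
  forall (f : X -> 'rV[R]_d) (e : R), continuous f -> 0 < e ->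
    exists g : X -> 'rV[R]_d,
    [/\ continuous g, forall z, `|g z - f z| <= e & forall j, Q j g].
Proof.
move=> dQ f0 e0 cf0 e0_gt0.
pose ok (s : (X -> 'rV[R]_d) * R) := continuous s.1 /\ 0 < s.2.
pose near (s : (X -> 'rV[R]_d) * R) g := forall z, `|g z - s.1 z| <= s.2.
have step (js : nat * ((X -> 'rV[R]_d) * R)) :
    exists s' : (X -> 'rV[R]_d) * R, ok js.2 ->
    [/\ ok s', s'.2 <= js.1.+1%:R^-1, forall g, near s' g -> near js.2 g &
      forall g, near s' g -> Q js.1 g].
  case: js => j [f e].
  have [[/= cf e_gt0]|nok] := pselect (ok (f, e)); last first.
    by exists (f, e).
  have e20 : 0 < e / 2 by rewrite divr_gt0.
  have [g [cg gf [e' e'0 gQ]]] := dQ j f _ cf e20.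
  (* The three bounds keep the new ball inside the old one, enforce [Q j], and make the radii tend
     to 0. *)
  exists (g, Num.min (e / 2) (Num.min e' j.+1%:R^-1)) => _; split => /=.
  - by split => //=; rewrite !lt_min e20 e'0 invr_gt0 ltr0n.
  - by rewrite !ge_min lexx !orbT.
  - move=> g' gg' z; rewrite -(subrK (g z) (g' z)) -addrA /=.
    apply: le_trans (ler_normD _ _) _; have := gf z; have := gg' z => /=.
    by rewrite le_min => /andP[]; lra.
  - move=> g' gg'; apply: gQ => z; apply: le_trans (gg' z) _ => /=.
    by rewrite !ge_min lexx orbT.
have [nxt nxtP] := choice step.
pose s := fix s j := if j is i.+1 then nxt (i, s i) else (f0, e0).
have sok j : ok (s j) by elim: j => // j IH; have [] := nxtP (j, s j) IH.
have nxts j := nxtP (j, s j) (sok j).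
have nested j l g : (j <= l)%N -> near (s l) g -> near (s j) g.
  move=> /subnK <-; elim: (l - j)%N => // i IH.
  by rewrite addSn => ?; apply: IH; have [_ _ + _] := nxts (i + j)%N; apply.
have self j : near (s j) (s j).1.
  by move=> z; rewrite subrr normr0; apply: ltW; have [] := sok j.
have small e : 0 < e -> exists j, (s j).2 < e.
  move=> /exists_inv_lt[j je]; exists j.+1; apply: le_lt_trans je.
  by have [] := nxts j.
have cvs z : cvg ((s j).1 z @[j --> \oo]).
  apply/cauchy_cvgP/cauchy_exP => e /small[j je].
  exists ((s j).1 z), j => // l /= jl.
  rewrite -ball_normE /= distrC; apply: le_lt_trans je.
  by have := nested _ _ _ jl (self l) z.
pose g z := lim ((s j).1 z @[j --> \oo]).
have gs j : near (s j) g.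
  move=> z; apply/ler_addgt0Pr => e e_gt0.
  have /cvgrPdist_lt/(_ _ e_gt0)[l _ le] := cvs z.
  have := le (maxn j l) (leq_maxr _ _) => /= H.
  have := nested _ _ _ (leq_maxl j l) (self (maxn j l)) z.
  rewrite -/(g z) in H.
  have -> : g z - (s j).1 z = (g z - (s (maxn j l)).1 z) +
     ((s (maxn j l)).1 z - (s j).1 z) by rewrite addrA subrK.
  by move=> H'; apply: le_trans (ler_normD _ _) _; move: H H'; lra.
exists g; split.
- apply: continuous_uniform_approx => e /small[j je].
  exists (s j).1; first by have [] := sok j.
  by move=> z; apply: le_trans (gs j z) (ltW je).
- by move=> z; exact: (gs 0%N z).
- by move=> j; have [_ _ _ H] := nxts j; apply: H; exact: (gs j.+1).
Qed.

(** * Pairs of periodic points *)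

(** Finitely many inequalities between iterates, selected by c, persist near x and y by continuity.
    The radius 3/(r+1) is that of a ball around x containing the 2/(r+1)-ball of any centre within
    1/(r+1) of x. *)
Lemma iter_separation (R : realType) (X : topologicalType)
    (dist : X -> X -> R) (T : X -> X) (n m : nat) (c : nat -> nat -> bool)
    (x y : X) :
  is_dist dist -> continuous T ->
  (forall i j, (i < n)%N -> (j < m)%N -> c i j -> iter i T x <> iter j T y) ->
  \forall r \near \oo, forall i j, (i < n)%N -> (j < m)%N -> c i j ->
    forall z z', dist x z < 3 / r.+1%:R -> dist y z' < 3 / r.+1%:R ->
      iter i T z <> iter j T z'.
Proof.
move=> dP cT xy; case: (dP) => d0 deq ds dt _.
suff : \forall r \near \oo, forall ij : 'I_n * 'I_m, c ij.1 ij.2 ->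
    forall z z', dist x z < 3 / r.+1%:R -> dist y z' < 3 / r.+1%:R ->
      iter ij.1 T z <> iter ij.2 T z'.
  by apply: filterS => r H i j im jm; exact: (H (Ordinal im, Ordinal jm)).
apply: filter_forall => -[i j] /=.
have [cij|_] := boolP (c i j); last by apply: nearW.
pose s := dist (iter i T x) (iter j T y) / 2.
have s0 : 0 < s.
  rewrite divr_gt0// lt_neqAle (dist_ge0 _ _ dP) andbT eq_sym.
  by apply/eqP => /deq; apply: xy.
have nb w k : exists2 e : R, 0 < e &
    [set z | dist w z < e] `<=` [set z | dist (iter k T w) (iter k T z) < s].
  apply: (nbhs_distP dP).
  exact: (continuous_iter (j := k) cT (nbhs_dist_ball (iter k T w) dP s0)).
have [e1 e10 H1] := nb x i; have [e2 e20 H2] := nb y j.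
have [k ke] : exists k : nat, k.+1%:R^-1 < Num.min e1 e2 / 3.
  by apply: exists_inv_lt; rewrite divr_gt0// lt_min e10.
exists k => // r /= kr _ z z' xz yz'.
have r3 : 3 / r.+1%:R < Num.min e1 e2.
  rewrite mulrC -ltr_pdivlMr//; apply: le_lt_trans ke.
  by rewrite lef_pV2 ?posrE ?ltr0n// ler_nat.
have := H1 z (lt_le_trans xz _); have := H2 z' (lt_le_trans yz' _).
move: r3; rewrite lt_min => /andP[r1 r2].
move=> /(_ (ltW r2)) /= b2 /(_ (ltW r1)) /= b1 zz'.
have := dt (iter i T z) (iter i T x) (iter j T y).
rewrite {2}zz' (ds (iter j T z')).
have : dist (iter i T x) (iter j T y) = s * 2 by rewrite /s divfK.
by move: b1 b2; lra.
Qed.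

Section periodic.
Variables (X : topologicalType) (T : homeo X X).

Lemma minimal_period_inj n x i j : minimal_period T n x ->
  (i < n)%N -> (j < n)%N -> iter i T x = iter j T x -> i = j.
Proof.
move=> [n0 nx nmin].
wlog ij : i j / (i <= j)%N.
  move=> W; have /orP[] := leq_total i j => ij i_n jn eij; first exact: W.
  by apply/esym/W.
move=> _ jn eij; apply/eqP; rewrite eqn_leq ij /= leqNgt; apply/negP => lij.
apply: (nmin (j - i)%N); first by lia.
have := congr1 (iter i (homeo_inv T)) eij.
by rewrite iter_homeo_invK -{1}(subnKC ij) iterD iter_homeo_invK.
Qed.

Lemma periodic_minimal_period x : periodic_points T x ->
  exists n, minimal_period T n x.
Proof. by move=> [n n0 /(periodic_upto_fixed n0)[m _ mx]]; exists m. Qed.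

Lemma iter_period_mul n k x : iter n T x = x -> iter (k * n) T x = x.
Proof. by move=> nx; rewrite -(iter_modn (k * n) nx) modnMl. Qed.

Lemma same_orbit_sym m x y l : minimal_period T m y -> iter l T y = x ->
  exists l', y = iter l' T x.
Proof.
(* Together with the first l steps this makes l full periods. *)
move=> [m0 my _] <-; exists (l * m - l)%N.
by rewrite -iterD subnK ?leq_pmulr// iter_period_mul.
Qed.

(** The values of g along the orbit have periods l and n, hence gcd(l, n) by a Bezout relation al =
    bn + gcd(l, n). *)
Lemma gcd_period (V : Type) (g : X -> V) n l x : (0 < l)%N -> iter n T x = x ->
  (forall i, g (iter i T x) = g (iter i T (iter l T x))) ->
  forall i, g (iter i T x) = g (iter i T (iter (gcdn l n) T x)).
Proof.
move=> l0 nx gl i.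
have per k j : g (iter j T x) = g (iter (j + k * l) T x).
  elim: k j => [|k IH] j; first by rewrite addn0.
  by rewrite IH gl -iterD mulSn (addnC l) addnA.
case: (egcdnP n l0) => a b ab _.
have -> : iter i T (iter (gcdn l n) T x) = iter (i + a * l) T x;
  last exact: per.
by rewrite ab (addnC (b * n)%N) !iterD iter_period_mul.
Qed.

End periodic.

(** * Countably many compact pieces of periodic points *)

Section pieces.
Variables (R : realType) (X : topologicalType) (dist : X -> X -> R).
Variables (T : homeo X X) (d : nat).
Hypothesis dP : is_dist dist.
Hypothesis Xc : compact [set: X].
Hypothesis pd : (perdim T R < (d%:R / 2)%:E)%E.

Let cT : continuous T := @homeo_fun_continuous _ _ T.
Let Xm : metrizable R X := ex_intro _ dist dP.

Definition piece_nbhs (r : nat) (p : X) : set X :=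
  [set z | dist p z < 2 / r.+1%:R].

(** Fixed points of T^n, and not points of minimal period n, so that the piece is closed. In a good
    piece the disjointness of the images forces minimal period n. *)
Definition piece (r n : nat) (p : X) : set X :=
  [set z | dist p z <= r.+1%:R^-1 /\ iter n T z = z].

Definition good_piece (r n : nat) (p : X) :=
  (0 < n)%N /\ orbit_disjoint T n (piece_nbhs r p).

Lemma closed_piece r n p : closed (piece r n p).
Proof.
rewrite -openC; case: (dP) => _ _ _ _ dopen; apply/dopen => z /= nz.
have [zn|nzn] := pselect (iter n T z = z); last first.
  (* The only pair compared is T^n z with z, so that nearby points are not fixed by T^n either. *)
  have [|r0 _ H] := @iter_separation _ _ _ T n.+1 1
    (fun i j => (i == n) && (j == 0)%N) z z dP cT.
    by move=> i j _ _ /andP[/eqP-> /eqP->].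
  exists (3 / r0.+1%:R); first by rewrite divr_gt0 ?ltr0n.
  move=> y /= zy [_]; apply: (H r0 (leqnn _) n 0%N _ _ _ y y) => //.
  by rewrite !eqxx.
have pz : r.+1%:R^-1 < dist p z.
  by rewrite ltNge; apply/negP => pz; apply: nz; split.
exists (dist p z - r.+1%:R^-1); first by rewrite subr_gt0.
move=> y /= zy [py _]; case: (dP) => _ _ ds dt _.
by have := dt y p z; rewrite (ds y z); move: zy py; set s := _^-1; lra.
Qed.

Lemma compact_piece r n p : compact (piece r n p).
Proof. exact: (subclosed_compact (@closed_piece r n p) Xc). Qed.

Lemma piece_sub r n p : piece r n p `<=` piece_nbhs r p.
Proof.
move=> z [pz _]; apply: (le_lt_trans pz).
by rewrite -[ltLHS]mul1r ltr_pM2r ?invr_gt0 ?ltr0n// ltr1n.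
Qed.

(** The requirements on the data are premises, so that the condition is vacuous for unsuitable data
    and can be imposed for all indices. *)
Definition separates_distinct (r n m : nat) (p q : X) (g : X -> 'rV[R]_d) :=
  good_piece r n p -> good_piece r m q -> (n <= m)%N ->
  (forall i j, (i < n)%N -> (j < m)%N ->
    forall y z, piece_nbhs r p y -> piece_nbhs r q z ->
    iter i T y <> iter j T z) ->
  separates T (piece r n p `*` piece r m q) g.

Definition separates_same (r n l : nat) (p : X) (g : X -> 'rV[R]_d) :=
  good_piece r n p -> (0 < l)%N -> (l < n)%N -> (l %| n)%N ->
  separates T [set (x, iter l T x) | x in piece r n p] g.

Lemma robust_separates_distinct r n m p q (f : X -> 'rV[R]_d) (e : R) :
  continuous f -> 0 < e -> exists g : X -> 'rV[R]_d,
    [/\ continuous g, forall z, `|g z - f z| <= e &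
      exists2 e', 0 < e' & forall g', (forall z, `|g' z - g z| <= e') ->
        separates_distinct r n m p q g'].
Proof.
move=> cf e0.
have [[gp [gq [nm cross]]]|bad] := pselect (good_piece r n p /\
  good_piece r m q /\ (n <= m)%N /\ (forall i j, (i < n)%N -> (j < m)%N ->
    forall y z, piece_nbhs r p y -> piece_nbhs r q z ->
    iter i T y <> iter j T z)); last first.
  exists f; split => // [z|]; first by rewrite subrr normr0 ltW.
  by exists 1 => // g' _ gp gq nm cross; case: bad.
case: (gp) (gq) => [n0 disj] [m0 disj'].
have [||g [cg gf gsep]] := @distinct_orbits_perturbation R X T d n m
  _ _ _ _ f e Xc Xm pd n0 nm (open_dist_ball p _ dP) (@closed_piece r n p)
  (@piece_sub r n p) _ disj (open_dist_ball q _ dP) (@closed_piece r m q)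
  (@piece_sub r m q) _ disj' cross cf e0.
- by move=> x [].
- by move=> x [].
exists g; split => //.
have [e' e'0 H] := @separates_open R X T d m _ g cT
  (compact_setX (@compact_piece r n p) (@compact_piece r m q)) cg
  (fun z Kz => gsep _ _ Kz.1 Kz.2).
by exists e' => // g' gg' _ _ _ _; exact: H.
Qed.

Lemma robust_separates_same r n l p (f : X -> 'rV[R]_d) (e : R) :
  continuous f -> 0 < e -> exists g : X -> 'rV[R]_d,
    [/\ continuous g, forall z, `|g z - f z| <= e &
      exists2 e', 0 < e' & forall g', (forall z, `|g' z - g z| <= e') ->
        separates_same r n l p g'].
Proof.
move=> cf e0.
have [[gp [l0 [ln ldvd]]]|bad] := pselect (good_piece r n p /\
  (0 < l)%N /\ (l < n)%N /\ (l %| n)%N); last first.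
  exists f; split => // [z|]; first by rewrite subrr normr0 ltW.
  by exists 1 => // g' _ gp l0 ln ldvd; case: bad.
case: (gp) => [n0 disj].
have [|g [cg gf gsep]] := @same_orbit_perturbation R X T d n l
  _ _ f e Xc Xm pd l0 ln ldvd (open_dist_ball p _ dP) (@closed_piece r n p)
  (@piece_sub r n p) _ disj cf e0.
  by move=> x [].
exists g; split => //.
have cK : compact [set (x, iter l T x) | x in piece r n p].
  apply: continuous_compact; last exact: compact_piece.
  apply: continuous_subspaceT => x; apply: cvg_pair; first exact: cvg_id.
  exact: continuous_iter.
have [|e' e'0 H] := @separates_open R X T d n _ g cT cK cg.
  by move=> _ [x Ax <-]; exact: gsep.
by exists e' => // g' gg' _ _ _ _; exact: H.
Qed.

Lemma exists_net : exists net : nat -> seq X, forall r z,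
  exists2 p, p \in net r & dist p z < r.+1%:R^-1.
Proof.
have net_ r : exists s : seq X, forall z,
    exists2 p, p \in s & dist p z < r.+1%:R^-1.
  apply: (@compact_open_cover X
    (fun p => [set z | dist p z < r.+1%:R^-1]) Xc).
    by move=> x; exact: open_dist_ball.
  by move=> x /=; case: (dP) => -> *; rewrite invr_gt0 ltr0n.
by have [net netP] := choice net_; exists net.
Qed.

Lemma exists_separating (x0 : X) (f : X -> 'rV[R]_d) (e : R) :
  continuous f -> 0 < e ->
  exists (g : X -> 'rV[R]_d) (net : nat -> seq X),
    [/\ continuous g, forall z, `|g z - f z| <= e,
      forall r z, exists2 p, p \in net r & dist p z < r.+1%:R^-1,
      forall r n m p q, p \in net r -> q \in net r ->
        separates_distinct r n m p q g &
      forall r n l p, p \in net r -> separates_same r n l p g].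
Proof.
move=> cf e0; have [net netP] := exists_net.
(* All conditions are listed by a countable type: the boolean selects the kind, and centres are
   named by their positions in the net. *)
pose I : countType := ((bool * (nat * nat * nat)) * (nat * nat))%type.
pose Q k (g : X -> 'rV[R]_d) :=
  if @choice.unpickle I k is Some (b, (r, n, m), (i, j)) then
    if b then separates_distinct r n m (nth x0 (net r) i) (nth x0 (net r) j) g
    else separates_same r n m (nth x0 (net r) i) g
  else True.
have [|g [cg gf gQ]] := @baire_continuous R X d Q _ f e cf e0.
  move=> k f' e' cf' e'0; rewrite /Q.
  case: choice.unpickle => [[[[] [[r n] m]] [i j]]|].
  - exact: robust_separates_distinct.
  - exact: robust_separates_same.
  - exists f'; split => // [z|]; first by rewrite subrr normr0 ltW.
    by exists 1.
exists g, net; split => //.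
- move=> r n m p q ip iq.
  have := gQ (@choice.pickle I
    (true, (r, n, m), (index p (net r), index q (net r)))).
  by rewrite /Q choice.pickleK !nth_index.
- move=> r n l p ip.
  have := gQ (@choice.pickle I (false, (r, n, l), (index p (net r), 0%N))).
  by rewrite /Q choice.pickleK !nth_index.
Qed.

Section separation.
Variables (g : X -> 'rV[R]_d) (net : nat -> seq X).
Hypothesis netP : forall r z, exists2 p, p \in net r & dist p z < r.+1%:R^-1.
Hypothesis gdist : forall r n m p q, p \in net r -> q \in net r ->
  separates_distinct r n m p q g.
Hypothesis gsame : forall r n l p, p \in net r -> separates_same r n l p g.

Lemma piece_nbhs_close r p x z : dist p x < r.+1%:R^-1 -> piece_nbhs r p z ->
  dist x z < 3 / r.+1%:R.
Proof.
case: (dP) => _ _ ds dt _ px pz; have := dt p x z; rewrite (ds x p).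
by move: px pz; rewrite /piece_nbhs /=; set s := _^-1; lra.
Qed.

Lemma near_good_piece n x : minimal_period T n x ->
  \forall r \near \oo, forall p, dist p x < r.+1%:R^-1 -> good_piece r n p.
Proof.
move=> nx; have n0 : (0 < n)%N by case: nx.
have inj i j : (i < n)%N -> (j < n)%N -> i != j -> iter i T x <> iter j T x.
  move=> i_n jn /eqP ij eij; apply: ij.
  exact: minimal_period_inj nx i_n jn eij.
apply: filterS (iter_separation (c := fun i j => i != j) dP cT inj) => r H p px.
split => // i j i_n jn y z Oy Oz eyz.
apply: contrapT => /eqP ij.
exact: (H i j i_n jn ij y z (piece_nbhs_close px Oy) (piece_nbhs_close px Oz)).
Qed.

(** For r large, net points close to x and y are centres of good pieces containing them, whose
    neighbourhoods have disjoint orbits; the condition imposed on that pair of pieces applies. *)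
Lemma separated_distinct n m x y : minimal_period T n x ->
  minimal_period T m y -> (forall l, y <> iter l T x) -> (n <= m)%N ->
  exists i, g (iter i T x) <> g (iter i T y).
Proof.
move=> nx my yx nm.
have cross i j : iter i T x <> iter j T y.
  (* From T^j y, a further jm - j steps lead back to y. *)
  move=> exy; case: (my) => m0 myy _; apply: (yx (j * m - j + i)%N).
  by rewrite iterD exy -iterD subnK ?leq_pmulr// iter_period_mul.
have := @iter_separation _ _ _ T n m (fun _ _ => true) x y dP cT.
move=> /(_ (fun i j _ _ _ => cross i j)) H.
have [r [Hr [gx gy]]] := filter_ex (filterI H
  (filterI (near_good_piece nx) (near_good_piece my))).
have [p ip px] := netP r x; have [q iq qy] := netP r y.
have := gdist (n := n) (m := m) ip iq (gx p px) (gy q qy) nm.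
move=> /(_ _ (x, y)); apply.
  move=> i j i_n jm y' z' py' qz'.
  exact: (Hr i j i_n jm isT y' z' (piece_nbhs_close px py')
    (piece_nbhs_close qy qz')).
split; split => /=; [exact: ltW| |exact: ltW| ].
  by case: nx.
by case: my.
Qed.

(** The shift l need not divide n, but failure to separate x from T^l x passes to the shift gcd(l,
    n), a proper divisor of n, which is excluded. *)
Lemma separated_same n l x : minimal_period T n x -> iter l T x <> x ->
  exists i, g (iter i T x) <> g (iter i T (iter l T x)).
Proof.
move=> nx lx; apply: contrapT => nosep.
have gl i : g (iter i T x) = g (iter i T (iter l T x)).
  by apply: contrapT => ne; apply: nosep; exists i.
have l0 : (0 < l)%N by rewrite lt0n; apply/eqP => l0; apply: lx; rewrite l0.
case: (nx) => n0 nxx nmin.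
have qn : (gcdn l n < n)%N.
  rewrite ltn_neqAle dvdn_leq ?dvdn_gcdr// andbT; apply/eqP => qn.
  apply: lx; have /dvdnP[a ->] : (n %| l)%N by rewrite -qn dvdn_gcdl.
  exact: iter_period_mul.
have [r gx] := filter_ex (near_good_piece nx).
have [p ip px] := netP r x.
have q0 : (0 < gcdn l n)%N by rewrite gcdn_gt0 l0.
have := gsame ip (gx p px) q0 qn (dvdn_gcdr _ _).
move=> /(_ (x, iter (gcdn l n) T x))[|i].
  by exists x => //; split => //; exact: ltW.
by apply; exact: gcd_period.
Qed.

Lemma separated_periodic x y : periodic_points T x -> periodic_points T y ->
  x <> y -> exists i, g (iter i T x) <> g (iter i T y).
Proof.
move=> /periodic_minimal_period[n nx] /periodic_minimal_period[m my] xy.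
have [[l yl]|nl] := pselect (exists l, y = iter l T x).
  by rewrite yl; apply: (separated_same nx); rewrite -yl; apply/nesym.
have [nm|mn] := leqP n m.
  by apply: (separated_distinct nx my) => // l yl; apply: nl; exists l.
have [i gi] : exists i, g (iter i T y) <> g (iter i T x).
  apply: (separated_distinct my nx) => [l xl|]; last exact: ltnW.
  by apply: nl; apply: (same_orbit_sym my (esym xl)).
by exists i; exact/nesym.
Qed.

End separation.

End pieces.

(** * Perturbation inside the cube *)

Lemma cube_shrink (R : realType) (X : topologicalType) (d : nat)
    (f : X -> 'rV[R]_d) (e : R) : cube_maps R X d f -> 0 < e -> e <= 1 / 2 ->
  exists f' : X -> 'rV[R]_d, [/\ continuous f', forall z, `|f' z - f z| <= e &
    forall z i, e <= f' z ord0 i <= 1 - e].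
Proof.
move=> [cf f01] e0 e1.
(* Contraction towards the centre of the cube, leaving a margin [e] for later perturbations. *)
exists (fun z => (1 - 2 * e) *: f z + const_mx e); split.
- move=> z; apply: cvgD; last exact: cvg_cst.
  by apply: cvgZ; [exact: cvg_cst|exact: cf].
- move=> z; apply: rV_norm_le => [|i]; first exact: ltW.
  rewrite !mxE ler_norml; have /andP[] := f01 z i.
  by move: e0 e1; nra.
- move=> z i; rewrite !mxE; have /andP[] := f01 z i.
  by move: e0 e1; nra.
Qed.

Theorem mainTheorem1 (R : realType) (X : topologicalType) (T : homeo X X)
    (d : nat) (Xne : [set: X] !=set0) (Xc : compact [set: X])
    (Xm : metrizable R X) (d1 : (1 <= d)%N)
    (hdim : (perdim T R < (d%:R / 2)%:E)%E) :
  unif_dense_in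
    (separating_maps R d T
      ((periodic_points T `*` periodic_points T) `\`
        [set p : X * X | p.1 = p.2]))
    (cube_maps R X d).
Proof.
move=> f cubef e e0; case: Xne => x0 _; case: (Xm) => dist dP.
(* Shrinking and perturbing cost [h] each; a total of at most e/2 stays strictly below [e] after the
   supremum is taken. *)
pose h : R := Num.min (e / 4) (1 / 2).
have h0 : 0 < h by rewrite lt_min !divr_gt0.
have h1 : h <= 1 / 2 by rewrite ge_min lexx orbT.
have he : h <= e / 4 by rewrite ge_min lexx.
have [f' [cf' ff' f'01]] := cube_shrink cubef h0 h1.
have [g [net [cg gf' netP gdist gsame]]] :=
  exists_separating dP Xc hdim x0 cf' h0.
exists g.
  split.
    split=> // x i; have := f'01 x i; have := rV_coord_le (g x - f' x) i.
    move=> /le_trans/(_ (gf' x)); rewrite !mxE ler_norml.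
    by move=> /andP[? ?] /andP[? ?]; apply/andP; split; lra.
  move=> x y [[/= px py] xy].
  have [i gi] := separated_periodic dP netP gdist gsame px py xy.
  by exists (Posz i).
apply: (@le_lt_trans _ _ (h + h)%:E); last by rewrite lte_fin; lra.
apply: ge_ereal_sup => _ [x _ <-]; rewrite lee_fin.
rewrite distrC -(subrK (f' x) (g x)) -addrA.
by apply: le_trans (ler_normD _ _) _; rewrite lerD.
Qed.
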